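(* Let $n\geq1$ be an integer and let $M=\mathbb{F}_1[\mathbb{Z}/n\mathbb{Z}]=\mathbb{Z}/n\mathbb{Z}\cup\{0\}$, viewed as a commutative (pointed) monoid. Then $n=p^\ell-1$ for a prime power $p^\ell$ if and only if the set $A(M)$ is non-empty, where $A(M)$ is the set of maps $s:M\to M$ such that (i) $s$ commutes with its conjugates by multiplication by elements of $M^\times$; (ii) $s(0)=1$.
   Context: $\mathbb{F}_1[\mathbb{Z}/n\mathbb{Z}]$ is the multiplicative monoid obtained from the cyclic group of order $n$ (written multiplicatively, with unit $1$) by adjoining an absorbing element $0$; its group of invertible elements $M^\times$ is the cyclic group of order $n$. For $h\in M^\times$ let $R_h(x)=hx$; condition (i) means that $s\circ(R_h\circ s\circ R_h^{-1})=(R_h\circ s\circ R_h^{-1})\circ s$ for all $h\in M^\times$. The maps $s$ are not assumed to be bijective. A prime power is $p^\ell$ with $p$ prime and $\ell\ge1$. *)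

(* Defs.v *)
From HB Require Import structures.
From mathcomp Require Import all_boot all_fingroup zmodp.
From mathcomp.classical Require Import classical_sets.

Set Implicit Arguments.
Unset Strict Implicit.
Unset Printing Implicit Defensive.

Local Open Scope group_scope.

HB.mixin Record isComPointedMonoid M of Monoid M := {
  zerom : M;
  mulmC : forall x y : M, x * y = y * x;
  mul0m : forall x : M, zerom * x = zerom
}.

#[short(type="comPointedMonoidType")]
HB.structure Definition ComPointedMonoid :=
  { M of isComPointedMonoid M & Monoid M }.

Arguments zerom {_}.

Section PointedMonoid.
Variable M : comPointedMonoidType.

Definition invertible (h : M) : Prop := exists k : M, h * k = 1 /\ k * h = 1.

Definition mul_by (h : M) : M -> M := fun x => h * x.

Lemma mul_by_bij (h : M) : invertible h -> bijective (mul_by h).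
Proof.
case=> k [hk kh]; exists (mul_by k) => x; rewrite /mul_by mulgA.
  by rewrite kh mul1g.
by rewrite hk mul1g.
Qed.

(* For invertible h, Rinv is the inverse of the map mul_by h; it exists by
   mul_by_bij and is unique. *)
Definition commutes_with_conjugates (s : M -> M) : Prop :=
  forall (h : M) (Rinv : M -> M), invertible h ->
    cancel (mul_by h) Rinv -> cancel Rinv (mul_by h) ->
    s \o (mul_by h \o s \o Rinv) =1 (mul_by h \o s \o Rinv) \o s.

Definition A : set (M -> M) :=
  [set s | commutes_with_conjugates s /\ s zerom = 1]%classic.

End PointedMonoid.

Arguments A : clear implicits.

(* The adjoined absorbing element is None. 'I_n.-1.+1 is Z/nZ for every n >= 1,
   including n = 1, where 'Z_n would be Z/2Z; its group law, written *, is
   addition modulo n, with unit 1 = ord0. *)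
Definition F1_Zn (n : nat) : Type := option 'I_n.-1.+1.

Section F1Zn.
Variable n : nat.

Definition F1_mul (x y : F1_Zn n) : F1_Zn n :=
  match x, y with
  | Some g, Some h => Some (g * h)
  | _, _ => None
  end.

Definition F1_one : F1_Zn n := Some 1.

Lemma F1_mulA : associative F1_mul.
Proof. by move=> [x|] [y|] [z|] //=; rewrite mulgA. Qed.

Lemma F1_mul1 : left_id F1_one F1_mul.
Proof. by case=> [x|] //=; rewrite mul1g. Qed.

Lemma F1_mulC : commutative F1_mul.
Proof. by move=> [x|] [y|] //=; rewrite Zp_mulgC. Qed.

Lemma F1_mulr1 : right_id F1_one F1_mul.
Proof. by move=> x; rewrite F1_mulC F1_mul1. Qed.

HB.instance Definition _ := Finite.copy (F1_Zn n) (option 'I_n.-1.+1).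
HB.instance Definition _ :=
  isMonoid.Build (F1_Zn n) F1_mulA F1_mul1 F1_mulr1.

Lemma F1_mul0 (x : F1_Zn n) : (None : F1_Zn n) * x = None.
Proof. by []. Qed.

HB.instance Definition _ :=
  isComPointedMonoid.Build (F1_Zn n) F1_mulC F1_mul0.

Lemma F1_invertibleP (h : F1_Zn n) : invertible h <-> h <> zerom.
Proof.
case: h => [g|]; split=> //; last by case=> k [].
move=> _; exists (Some g^-1).
by split; congr Some; [exact: mulgV | exact: mulVg].
Qed.

End F1Zn.

Lemma card_Zn (n : nat) : 0 < n -> #|'I_n.-1.+1| = n.
Proof. by case: n => // n _; rewrite card_ord. Qed.

(* Main.v *)
Require Import Defs.
From HB Require Import structures.
From mathcomp Require Import all_boot all_algebra all_fingroup all_solvable.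
From mathcomp Require Import all_field.
From mathcomp.classical Require Import classical_sets.

Set Implicit Arguments.
Unset Strict Implicit.
Unset Printing Implicit Defensive.

Import GRing.Theory.

(** Maps in A(M) are the successor maps of the field structures that extend the
    multiplication of M.

    If M is the multiplicative monoid of a field, the conjugate of
    s(x) = x + 1 by multiplication by h is x |-> x + h, and translations
    commute; moreover s(0) = 1. The unit group of the field with p^l elements
    is cyclic of order p^l - 1, so this gives an element of A(M) when
    n = p^l - 1 ([A_of_field], [F1_Zn_finField]).

    Conversely, s in A(M) is turned into an addition: x + y is the image of x
    under the conjugate of s by y, and x + 0 = x. That all conjugates of s
    commute says (x + y) + z = (x + z) + y; since s(0) = 1 says 0 + y = y,
    taking x = 0 gives commutativity, and then the same identity gives
    associativity. Distributivity is built into the conjugation. So M becomes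
    a finite commutative semiring in which nonzero elements are invertible.

    The remaining point is to find -1, for which n > 1 is needed: the sum S of
    all elements is unchanged by multiplication by any unit a, and choosing
    a <> 1 forces S = 0, because a nonzero S could be cancelled from
    S a = S ([conj_field_sum]). Hence the sum of all elements other than 1 is
    an opposite of 1, M is a field, and n + 1 is a prime power. For n = 1 the
    semiring may be the Boolean one, but 1 = 2^1 - 1 anyway. *)

Section Monoid.
Variable n : nat.
Local Open Scope group_scope.
Implicit Types (g h : 'I_n.-1.+1) (x y : F1_Zn n).
Local Notation nz g := (Some g : F1_Zn n).

Definition F1_inv x : F1_Zn n := if x is Some g then nz g^-1 else None.

Lemma F1_mul_Some g h : nz (g * h) = nz g * nz h.
Proof. by []. Qed.

Lemma F1_mulVK g : cancel (mul_by (nz g)) (mul_by (nz g^-1)).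
Proof. by move=> x; rewrite /mul_by mulgA -F1_mul_Some mulVg; exact: mul1g. Qed.

Lemma F1_mulKV g : cancel (mul_by (nz g^-1)) (mul_by (nz g)).
Proof. by move=> x; rewrite -{1}[g]invgK F1_mulVK. Qed.

Lemma F1_mulVx x : x != None -> F1_mul (F1_inv x) x = F1_one n.
Proof. by case: x => [g|] //= _; rewrite mulVg. Qed.

End Monoid.

Section Addition.
Variables (n : nat) (s : F1_Zn n -> F1_Zn n) (sA : A (F1_Zn n) s).
Local Open Scope group_scope.
Local Notation nz g := (Some g : F1_Zn n).

(** For y <> 0 this is the conjugate of s by multiplication by y, evaluated at
    x; it is the sum x + y = y (x / y + 1) with s in the role of the successor
    map. *)
Definition conj_add (x y : F1_Zn n) : F1_Zn n :=
  if y is Some g then nz g * s (nz g^-1 * x) else x.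

(** The hypothesis relates s and its conjugates only; conjugating it by g
    shows that the conjugates by g and by h commute, being the conjugates by g
    of s and of its conjugate by g^-1 h. *)
Lemma conj_addAC : right_commutative conj_add.
Proof.
move=> x [g|] [h|] //=; have [sC _] := sA.
have k_unit : invertible (nz (g^-1 * h)) by apply/F1_invertibleP.
have /(congr1 (mul_by (nz g))) :=
  sC _ _ k_unit (@F1_mulVK n _) (@F1_mulKV n _) (nz g^-1 * x).
rewrite /= /mul_by invMg invgK !F1_mul_Some -!mulgA.
by rewrite ![nz g * (nz g^-1 * _)]F1_mulKV => ->.
Qed.

Lemma conj_add0x : left_id None conj_add.
Proof.
case=> [g|] //=; have [_ s0] := sA.
by rewrite s0 mulg1.
Qed.

(** Exchanging the two summands in (0 + x) + y. *)
Lemma conj_addC : commutative conj_add.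
Proof. by move=> x y; rewrite -{1}[x]conj_add0x conj_addAC conj_add0x. Qed.

Lemma conj_addA : associative conj_add.
Proof.
by move=> x y z; rewrite conj_addC conj_addAC [conj_add y x]conj_addC.
Qed.

Lemma conj_mulDl : left_distributive (@F1_mul n) conj_add.
Proof.
move=> x y a; rewrite ![F1_mul _ a]F1_mulC.
case: a => [a|] //; case: y => [g|] //.
rewrite -[RHS]/(nz (a * g) * s (nz (a * g)^-1 * (nz a * x))) invMg.
rewrite -[LHS]/(nz a * (nz g * s (nz g^-1 * x))).
by rewrite !F1_mul_Some -!mulgA [nz a^-1 * (nz a * _)]F1_mulVK.
Qed.

End Addition.

Section Field.
Variables (n : nat) (s : F1_Zn n -> F1_Zn n) (sA : A (F1_Zn n) s).
Hypothesis n_gt1 : 1 < n.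

(** The proofs occur in vacuous bindings so that they are parameters of the
    type, from which the algebraic structures declared on it recover s. *)
Definition conj_field : Type := let _ := sA in let _ := n_gt1 in F1_Zn n.

HB.instance Definition _ := Finite.copy conj_field (F1_Zn n).
HB.instance Definition _ := GRing.isNmodule.Build conj_field
  (conj_addA sA) (conj_addC sA) (conj_add0x sA).
HB.instance Definition _ := GRing.Nmodule_isComNzSemiRing.Build conj_field
  (@F1_mulA n) (@F1_mulC n) (@F1_mul1 n) (conj_mulDl s) (@F1_mul0 n) isT.

Local Open Scope ring_scope.

Lemma conj_field_unit (x : conj_field) : x != 0 ->
  (F1_inv x : conj_field) * x = 1.
Proof. exact: F1_mulVx. Qed.

Lemma conj_field_mulI (x : conj_field) : x != 0 -> injective ( *%R x).
Proof.
move=> /conj_field_unit xV y z /(congr1 ( *%R (F1_inv x : conj_field))).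
by rewrite !mulrA xV !mul1r.
Qed.

(** Multiplication by a unit permutes the elements, so it fixes their sum; a
    unit other than 1 exists because n > 1, and it can only fix 0. *)
Lemma conj_field_sum : \sum_(x : conj_field) x = 0.
Proof.
(* The additive generator of Z/nZ, which differs from the unit 0 of that group
   when n > 1. *)
pose a : conj_field := Some (@inord n.-1 1).
have a1 : a != 1.
  apply/eqP => -[] /(congr1 val) /=; rewrite inordK //.
  by case: (n) n_gt1 => [|[]].
set S := \sum_x x; apply: contraNeq a1 => S0.
apply/eqP/(conj_field_mulI S0); rewrite mulr1 mulrC.
by rewrite /S mulr_sumr [RHS](reindex_inj (@conj_field_mulI a isT)).
Qed.

Definition conj_field_opp1 : conj_field := \sum_(x : conj_field | x != 1) x.

Lemma conj_field_addNr :
  left_inverse (0 : conj_field) (fun x => conj_field_opp1 * x) +%R.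
Proof.
move=> x; rewrite -[X in _ + X]mul1r -mulrDl addrC.
have := conj_field_sum; rewrite (bigD1 (1 : conj_field)) //= => ->.
exact: mul0r.
Qed.

HB.instance Definition _ :=
  GRing.Nmodule_isZmodule.Build conj_field conj_field_addNr.
HB.instance Definition _ :=
  GRing.ComNzRing_isField.Build conj_field conj_field_unit (erefl _).

Lemma card_conj_field : #|{: conj_field}| = n.+1.
Proof.
by rewrite -[LHS]/(#|{: option 'I_n.-1.+1}|) card_option card_Zn // ltnW.
Qed.

End Field.

(** The additive group is an elementary abelian p-group, where p is the
    characteristic. *)
Lemma card_finField (F : finFieldType) :
  exists p l : nat, [/\ prime p, 0 < l & #|F| = p ^ l].
Proof.
have [p p_pr /fin_ring_pchar_abelem /abelem_pgroup /card_pgroup] := finPcharP F.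
rewrite cardsT => cardF; exists p, (logn p #|F|); split=> //.
by have := finNzRing_gt1 F; rewrite cardF pfactorK //; case: logn.
Qed.

(** The map is x |-> x + 1 transported along f; its conjugates are the
    translations. *)
Lemma A_of_field (n : nat) (F : fieldType) (f : F1_Zn n -> F) :
  bijective f -> f None = 0%R ->
  {morph f : x y / (x * y)%g >-> (x * y)%R} ->
  (A (F1_Zn n) !=set0)%classic.
Proof.
move=> f_bij f0 fM; have [f' fK f'K] := f_bij.
have f1 : f 1%g = 1%R.
  have f1_neq0 : (f 1%g != 0)%R by rewrite -f0 (inj_eq (can_inj fK)).
  by apply: (mulfI f1_neq0); rewrite mulr1 -fM mul1g.
exists (fun x => f' (f x + 1)%R); split=> [h Rinv _ _ RinvK x|].
  apply: (can_inj fK) => /=; rewrite /mul_by.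
  (* The conjugate by h adds f h. *)
  have trans y : f (mul_by h (f' (f (Rinv y) + 1)%R)) = (f y + f h)%R.
    by rewrite fM f'K mulrDr mulr1 -fM [(h * _)%g]RinvK.
  by rewrite f'K !trans f'K addrAC.
by rewrite f0 add0r -f1 fK.
Qed.

(** The bijection is given by the powers of a generator of the unit group,
    which is cyclic. *)
Lemma F1_Zn_finField (n : nat) (F : finFieldType) : 0 < n -> #|F| = n.+1 ->
  exists f : F1_Zn n -> F, [/\ bijective f, f None = 0%R &
    {morph f : x y / (x * y)%g >-> (x * y)%R}].
Proof.
move=> n_gt0 cardF.
have /cyclicP [g gE] := field_unit_group_cyclic [set: {unit F}]%G.
have og : #[g]%g = n by rewrite orderE -gE card_finField_unit cardF.
pose f (x : F1_Zn n) : F := if x is Some i then val (g ^+ i)%g else 0%R.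
have f_inj : injective f.
  move=> [i|] [j|] //=.
  - move/val_inj/eqP; rewrite eq_expg_mod_order og => /eqP.
    have lt_n (k : 'I_n.-1.+1) : k < n by case: k => k /=; rewrite prednK.
    by rewrite !modn_small // => /val_inj ->.
  - by move/eqP; rewrite -[_ == _]negbK -unitfE (valP (g ^+ i)%g).
  - by move/esym/eqP; rewrite -[_ == _]negbK -unitfE (valP (g ^+ j)%g).
exists f; split=> //.
  apply: inj_card_bij f_inj _.
  by rewrite cardF -[X in _ <= X]/(#|{: option _}|) card_option card_Zn.
move=> [i|] [j|] /=; rewrite ?mulr0 ?mul0r //.
rewrite -[RHS]/(val (g ^+ i * g ^+ j)%g) -expgD; congr val; apply/eqP.
by rewrite eq_expg_mod_order og /= [X in _ %% X %% _]prednK ? modn_mod.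
Qed.

Theorem corollary5p4 (n : nat) (hn : 1 <= n) :
  (exists p l : nat, prime p /\ 1 <= l /\ n = p ^ l - 1) <->
  (A (F1_Zn n) !=set0)%classic.
Proof.
split=> [[p [l [p_pr [l_gt0 nE]]]] | [s sA]].
  have [F _ cardF] := pPrimePowerField p_pr l_gt0.
  have cardFn : #|F| = n.+1.
    by rewrite cardF nE subn1 prednK // expn_gt0 prime_gt0.
  have [f [f_bij f0 fM]] := F1_Zn_finField hn cardFn.
  exact: A_of_field f_bij f0 fM.
have [n_gt1|n_le1] := ltnP 1 n; last first.
  by exists 2, 1; do 2!split=> //; apply/eqP; rewrite eqn_leq n_le1.
have [p [l [p_pr l_gt0]]] := card_finField (conj_field sA n_gt1).
rewrite card_conj_field // => nE.
by exists p, l; do 2!split=> //; rewrite -nE subn1.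
Qed.
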